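(* The pair $(I^{\mathrm{syn}},O^{\mathrm{syn}})$ of syntactic inputs and outputs is a sound input--output definition. That is, for every LIF expression $\alpha$: (1) if $\alpha$ is an atomic module expression $M(\bar x;\bar y)$, then $I^{\mathrm{syn}}(\alpha)$ is the set of variables in $\bar x$ and $O^{\mathrm{syn}}(\alpha)$ is the set of variables in $\bar y$; (2) $O^{\mathrm{syn}}(\alpha)\supseteq O^{\mathrm{sem}}(\alpha)$; and (3) $I^{\mathrm{syn}}(\alpha)$ determines $[\![\alpha]\!]$ on $O^{\mathrm{syn}}(\alpha)$.
   Context: **Basic setting.** Fix a vocabulary $\mathcal S$: a nonempty set of module names, each module name $M$ having an arity $ar(M)$ and an input arity $iar(M)\le ar(M)$ (natural numbers). Fix a countably infinite set $\mathbf{dom}$. An interpretation $D$ of $\mathcal S$ assigns to each module name $M$ an $ar(M)$-ary relation $D(M)$ over $\mathbf{dom}$. Fix a set $\mathbb V$ of variables (finite or infinite). A valuation is a function $\mathbb V\to\mathbf{dom}$; $\mathcal V$ is the set of all valuations. Valuations agree on $Y\subseteq\mathbb V$ if they have equal values on every $y\in Y$; they agree outside $Y$ if they agree on $\mathbb V- Y$. A BRV is a subset of $\mathcal V\times\mathcal V$; a global BRV is a function $Q$ mapping each interpretation $D$ to a BRV $Q(D)$. **Operations on BRVs** $A,B$ ($Z$ a finite set of variables; $x,y$ variables): union, intersection, set difference $A-B$; composition $A;B=\{(\nu_1,\nu_2)\mid\exists\nu_3:(\nu_1,\nu_3)\in A,(\nu_3,\nu_2)\in B\}$; converse $A^{-1}=\{(\nu_1,\nu_2)\mid(\nu_2,\nu_1)\in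 A\}$; left cylindrification $\mathrm{cyl}^l_Z(A)=\{(\nu_1,\nu_2)\mid\exists\nu_1':(\nu_1',\nu_2)\in A,\ \nu_1'\text{ and }\nu_1\text{ agree outside }Z\}$; right cylindrification $\mathrm{cyl}^r_Z(A)=\{(\nu_1,\nu_2)\mid\exists\nu_2':(\nu_1,\nu_2')\in A,\ \nu_2'\text{ and }\nu_2\text{ agree outside }Z\}$; selections $\sigma^l_{x=y}(A)=\{(\nu_1,\nu_2)\in A\mid\nu_1(x)=\nu_1(y)\}$, $\sigma^r_{x=y}(A)=\{(\nu_1,\nu_2)\in A\mid\nu_2(x)=\nu_2(y)\}$, $\sigma^{lr}_{x=y}(A)=\{(\nu_1,\nu_2)\in A\mid\nu_1(x)=\nu_2(y)\}$. **LIF expressions** over $\mathcal S$ are generated by $\alpha::=\mathit{id}\mid M(\bar x;\bar y)\mid\alpha\cup\alpha\mid\alpha\cap\alpha\mid\alpha-\alpha\mid\alpha;\alpha\mid\alpha^{-1}\mid\mathrm{cyl}^l_Z(\alpha)\mid\mathrm{cyl}^r_Z(\alpha)\mid\sigma^{lr}_{x=y}(\alpha)\mid\sigma^l_{x=y}(\alpha)\mid\sigma^r_{x=y}(\alpha)$, where in an atomic module expression $M(\bar x;\bar y)$ the tuples of variables $\bar x,\bar y$ have lengths $iar(M)$ and $ar(M)-iar(M)$. Semantics: $[\![\mathit{id}]\!]_D=\{(\nu,\nu)\mid\nu\in\mathcal V\}$; $[\![M(\bar x;\bar y)]\!]_D=\{(\nu_1,\nu_2)\mid\nu_1(\bar x)\cdot\nu_2(\bar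 y)\in D(M)\text{ and }\nu_1,\nu_2\text{ agree outside }\bar y\}$ ($\cdot$ is concatenation of tuples); the other operators are interpreted by the corresponding BRV operations. $[\![\alpha]\!]$ denotes the global BRV $D\mapsto[\![\alpha]\!]_D$. **Semantic outputs.** $O^{\mathrm{sem}}(\alpha)$ is the set of variables $x$ for which there are an interpretation $D$ and $(\nu_1,\nu_2)\in[\![\alpha]\!]_D$ with $\nu_1(x)\ne\nu_2(x)$. **Determinacy.** For a global BRV $Q$ and $X,Y\subseteq\mathbb V$, $X$ determines $Q$ on $Y$ if for every interpretation $D$, every $(\nu_1,\nu_2)\in Q(D)$ and every valuation $\nu_1'$ agreeing with $\nu_1$ on $X$, there is $\nu_2'$ agreeing with $\nu_2$ on $Y$ such that $(\nu_1',\nu_2')\in Q(D)$. **Syntactic inputs and outputs** (write $I,O$ for $I^{\mathrm{syn}},O^{\mathrm{syn}}$; $\triangle$ is symmetric difference), recursively: - $I(\mathit{id})=O(\mathit{id})=\emptyset$. - $I(M(\bar x;\bar y))$ is the set of variables in $\bar x$; $O(M(\bar x;\bar y))$ is the set of variables in $\bar y$. - For $\alpha_1\cup\alpha_2$, $\alpha_1\cap\alpha_2$, $\alpha_1-\alpha_2$: the inputs are $I(\alpha_1)\cup I(\alpha_2)\cup(O(\alpha_1)\triangle O(\alpha_2))$; the outputs are $O(\alpha_1)\cup O(\alpha_2)$, $O(\alpha_1)\cap O(\alpha_2)$, $O(\alpha_1)$ respectively. - $I(\alpha_1;\alpha_2)=I(\alpha_1)\cup(I(\alpha_2)-O(\alpha_1))$;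 $O(\alpha_1;\alpha_2)=O(\alpha_1)\cup O(\alpha_2)$. - $I(\alpha_1^{-1})=O(\alpha_1)\cup I(\alpha_1)$; $O(\alpha_1^{-1})=O(\alpha_1)$. - $I(\mathrm{cyl}^l_Z(\alpha_1))=I(\alpha_1)-Z$; $O(\mathrm{cyl}^l_Z(\alpha_1))=O(\alpha_1)\cup Z$. - $I(\mathrm{cyl}^r_Z(\alpha_1))=I(\alpha_1)$; $O(\mathrm{cyl}^r_Z(\alpha_1))=O(\alpha_1)\cup Z$. - $I(\sigma^{lr}_{x=y}(\alpha_1))$ is $I(\alpha_1)$ if $x,y$ are the same variable and $y\notin O(\alpha_1)$; it is $I(\alpha_1)\cup\{x,y\}$ if $x,y$ are different variables and $y\notin O(\alpha_1)$; it is $I(\alpha_1)\cup\{x\}$ otherwise. $O(\sigma^{lr}_{x=y}(\alpha_1))$ is $O(\alpha_1)-\{x\}$ if $x,y$ are the same variable, and $O(\alpha_1)$ otherwise. - $I(\sigma^l_{x=y}(\alpha_1))$ is $I(\alpha_1)$ if $x,y$ are the same variable, and $I(\alpha_1)\cup\{x,y\}$ otherwise; $O(\sigma^l_{x=y}(\alpha_1))=O(\alpha_1)$. - $I(\sigma^r_{x=y}(\alpha_1))$ is $I(\alpha_1)$ if $x,y$ are the same variable, and $I(\alpha_1)\cup(\{x,y\}-O(\alpha_1))$ otherwise; $O(\sigma^r_{x=y}(\alpha_1))=O(\alpha_1)$. *)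

(* Defs.v *)
From mathcomp Require Import all_boot finmap.
From mathcomp Require Import boolp classical_sets cardinality.

Set Implicit Arguments.
Unset Strict Implicit.
Unset Printing Implicit Defensive.

Local Open Scope classical_set_scope.

Record vocabulary := Vocabulary {
  modname : Type;
  modname_inhabited : inhabited modname;
  ar : modname -> nat;
  iar : modname -> nat;
  iar_le_ar : forall M, iar M <= ar M
}.

Definition interpretation (S : vocabulary) (dom : Type) :=
  forall M : modname S, set ((ar M).-tuple dom).

Definition valuation (dom : Type) (V : choiceType) := V -> dom.

Section Valuations.
Variables (dom : Type) (V : choiceType).
Implicit Types (Y : set V) (nu : valuation dom V).

Definition agree_on Y nu1 nu2 : Prop := forall v, Y v -> nu1 v = nu2 v.

Definition agree_outside Y nu1 nu2 : Prop := agree_on (~` Y) nu1 nu2.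

End Valuations.

Definition brv (dom : Type) (V : choiceType) :=
  set (valuation dom V * valuation dom V).

Definition global_brv (S : vocabulary) (dom : Type) (V : choiceType) :=
  interpretation S dom -> brv dom V.

Section BrvOperations.
Variables (dom : Type) (V : choiceType).
Implicit Types (A B : brv dom V) (Z : {fset V}) (x y : V).

Definition brv_id : brv dom V := [set p | p.1 = p.2].

Definition brv_comp A B : brv dom V :=
  [set p | exists nu3, A (p.1, nu3) /\ B (nu3, p.2)].

Definition brv_conv A : brv dom V := [set p | A (p.2, p.1)].

Definition brv_cyl_l Z A : brv dom V :=
  [set p | exists nu1', A (nu1', p.2) /\ agree_outside [set` Z] nu1' p.1].

Definition brv_cyl_r Z A : brv dom V :=
  [set p | exists nu2', A (p.1, nu2') /\ agree_outside [set` Z] nu2' p.2].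

Definition brv_sel_l x y A : brv dom V := [set p | A p /\ p.1 x = p.1 y].

Definition brv_sel_r x y A : brv dom V := [set p | A p /\ p.2 x = p.2 y].

Definition brv_sel_lr x y A : brv dom V := [set p | A p /\ p.1 x = p.2 y].

End BrvOperations.

Inductive lif (S : vocabulary) (V : choiceType) : Type :=
| LId
| LAtom (M : modname S) of (iar M).-tuple V & (ar M - iar M).-tuple V
| LUnion of lif S V & lif S V
| LInter of lif S V & lif S V
| LDiff of lif S V & lif S V
| LComp of lif S V & lif S V
| LConv of lif S V
| LCylL of {fset V} & lif S V
| LCylR of {fset V} & lif S V
| LSelLR of V & V & lif S V
| LSelL of V & V & lif S V
| LSelR of V & V & lif S V.

Arguments LId {S V}.
Arguments LAtom {S V} M xs ys.

(* [tcast] identifies tuples of length iar M + (ar M - iar M) with tuples of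
   length ar M. *)
Definition brv_atom (S : vocabulary) (dom : Type) (V : choiceType)
    (D : interpretation S dom) (M : modname S)
    (xs : (iar M).-tuple V) (ys : (ar M - iar M).-tuple V) : brv dom V :=
  [set p | D M (tcast (subnKC (iar_le_ar M))
                      (cat_tuple (map_tuple p.1 xs) (map_tuple p.2 ys)))
           /\ agree_outside [set` ys] p.1 p.2].

Fixpoint sem (S : vocabulary) (dom : Type) (V : choiceType) (a : lif S V)
    (D : interpretation S dom) {struct a} : brv dom V :=
  match a with
  | LId => @brv_id dom V
  | LAtom M xs ys => brv_atom D xs ys
  | LUnion a1 a2 => sem a1 D `|` sem a2 D
  | LInter a1 a2 => sem a1 D `&` sem a2 D
  | LDiff a1 a2 => sem a1 D `\` sem a2 D
  | LComp a1 a2 => brv_comp (sem a1 D) (sem a2 D)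
  | LConv a1 => brv_conv (sem a1 D)
  | LCylL Z a1 => brv_cyl_l Z (sem a1 D)
  | LCylR Z a1 => brv_cyl_r Z (sem a1 D)
  | LSelLR x y a1 => brv_sel_lr x y (sem a1 D)
  | LSelL x y a1 => brv_sel_l x y (sem a1 D)
  | LSelR x y a1 => brv_sel_r x y (sem a1 D)
  end.

Definition global_sem (S : vocabulary) (dom : Type) (V : choiceType)
    (a : lif S V) : global_brv S dom V := fun D => sem a D.

Definition Osem (S : vocabulary) (dom : Type) (V : choiceType) (a : lif S V)
    : set V :=
  [set x | exists (D : interpretation S dom) (nu1 nu2 : valuation dom V),
             global_sem a D (nu1, nu2) /\ nu1 x <> nu2 x].

Definition determines (S : vocabulary) (dom : Type) (V : choiceType)
    (X : set V) (Q : global_brv S dom V) (Y : set V) : Prop :=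
  forall (D : interpretation S dom) (nu1 nu2 nu1' : valuation dom V),
    Q D (nu1, nu2) -> agree_on X nu1' nu1 ->
    exists nu2', agree_on Y nu2' nu2 /\ Q D (nu1', nu2').

Fixpoint Osyn (S : vocabulary) (V : choiceType) (a : lif S V) : set V :=
  match a with
  | LId => set0
  | LAtom M xs ys => [set` ys]
  | LUnion a1 a2 => Osyn a1 `|` Osyn a2
  | LInter a1 a2 => Osyn a1 `&` Osyn a2
  | LDiff a1 a2 => Osyn a1
  | LComp a1 a2 => Osyn a1 `|` Osyn a2
  | LConv a1 => Osyn a1
  | LCylL Z a1 => Osyn a1 `|` [set` Z]
  | LCylR Z a1 => Osyn a1 `|` [set` Z]
  | LSelLR x y a1 => if x == y then Osyn a1 `\` [set x] else Osyn a1
  | LSelL x y a1 => Osyn a1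
  | LSelR x y a1 => Osyn a1
  end.

Fixpoint Isyn (S : vocabulary) (V : choiceType) (a : lif S V) : set V :=
  match a with
  | LId => set0
  | LAtom M xs ys => [set` xs]
  | LUnion a1 a2 | LInter a1 a2 | LDiff a1 a2 =>
      Isyn a1 `|` Isyn a2 `|` (Osyn a1 `+` Osyn a2)
  | LComp a1 a2 => Isyn a1 `|` (Isyn a2 `\` Osyn a1)
  | LConv a1 => Osyn a1 `|` Isyn a1
  | LCylL Z a1 => Isyn a1 `\` [set` Z]
  | LCylR Z a1 => Isyn a1
  | LSelLR x y a1 =>
      if (x == y) && (y \notin Osyn a1) then Isyn a1
      else if (x != y) && (y \notin Osyn a1) then Isyn a1 `|` [set x; y]
      else Isyn a1 `|` [set x]
  | LSelL x y a1 => if x == y then Isyn a1 else Isyn a1 `|` [set x; y]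
  | LSelR x y a1 =>
      if x == y then Isyn a1 else Isyn a1 `|` ([set x; y] `\` Osyn a1)
  end.

Definition sound_io_definition (S : vocabulary) (dom : Type) (V : choiceType)
    (I O : lif S V -> set V) : Prop :=
  forall a : lif S V,
    [/\ forall (M : modname S) (xs : (iar M).-tuple V)
               (ys : (ar M - iar M).-tuple V),
          a = LAtom M xs ys -> I a = [set` xs] /\ O a = [set` ys],
        Osem dom a `<=` O a
      & determines (I a) (@global_sem S dom V a) (O a)].

(* Main.v *)
(** The semantics is inertial: related valuations agree outside the syntactic
    outputs.  Hence the valuation [nu2'] required by determinacy is forced: it
    is [nu2] on the outputs and [nu1'] elsewhere.  Both inertia and membership
    of this forced pair follow by one simultaneous induction; the difference
    case applies the induction hypothesis for the subtracted expression in the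
    reverse direction, from the primed pair to the original one. *)
Require Import Defs.
From mathcomp Require Import all_boot finmap.
From mathcomp Require Import boolp classical_sets cardinality.

Local Open Scope classical_set_scope.

Section Soundness.
Context {dom : Type} {V : choiceType}.
Implicit Types (I O : set V) (A B : brv dom V) (mu nu : valuation dom V).

Definition inertial O A : Prop :=
  forall nu1 nu2, A (nu1, nu2) -> agree_outside O nu1 nu2.

(** Quantifying over every admissible [nu2'], rather than asserting that one exists, lets two
    operands share the same primed pair, as intersection and difference require. *)
Definition transportable I O A : Prop :=
  forall nu1 nu2 nu1' nu2', A (nu1, nu2) ->
    agree_on I nu1' nu1 -> agree_on O nu2' nu2 -> agree_outside O nu1' nu2' ->
    A (nu1', nu2').

Definition merge O nu mu : valuation dom V :=
  fun v => if `[< O v >] then nu v else mu v.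

Lemma merge_in O nu mu : agree_on O (merge O nu mu) nu.
Proof. by move=> v /asboolP Ov; rewrite /merge Ov. Qed.

Lemma merge_out O nu mu : agree_outside O (merge O nu mu) mu.
Proof. by move=> v /asboolPn/negbTE nOv; rewrite /merge nOv. Qed.

Lemma agree_on_map (s : seq V) nu mu :
  agree_on [set` s] nu mu -> map nu s = map mu s.
Proof. by move=> agr; apply/eq_in_map => v vs; apply: agr. Qed.

Ltac unfold_sets :=
  rewrite /agree_outside /agree_on /setU /setI /setD /setY /setC /mkset /=.

(** After everything is evaluated at one variable [v], the classical split on [X v] leaves chains of
    equations. *)
Ltac by_membership X v :=
  unfold_sets; move: (EM (X v)); intuition congruence.

Lemma inertial_sub O O' A : O `<=` O' -> inertial O A -> inertial O' A.
Proof. by move=> sub inA nu1 nu2 /inA h v nOv; apply: h => /sub. Qed.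

(** * Set operations and composition *)

Section Binary.
Context {I1 O1 I2 O2 : set V} {A B : brv dom V}.
Hypotheses (inA : inertial O1 A) (inB : inertial O2 B).
Hypotheses (trA : transportable I1 O1 A) (trB : transportable I2 O2 B).

(** For a pair in [A], a variable in [O2] but not [O1] is an input through the symmetric difference.
    Inertia of [A] then gives [nu1' = nu1 = nu2 = nu2'] there, as agreement outside [O1] demands. *)
Lemma transportable_setU :
  transportable (I1 `|` I2 `|` (O1 `+` O2)) (O1 `|` O2) (A `|` B).
Proof.
move=> nu1 nu2 nu1' nu2' [h|h] hI hO hN; [left|right].
- apply: (trA _ _ _ _ h) => v; move: (hI v) (hO v) (hN v) (inA _ _ h v);
    by_membership O2 v.
- apply: (trB _ _ _ _ h) => v; move: (hI v) (hO v) (hN v) (inB _ _ h v);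
    by_membership O1 v.
Qed.

Lemma transportable_setI :
  transportable (I1 `|` I2 `|` (O1 `+` O2)) (O1 `&` O2) (A `&` B).
Proof.
move=> nu1 nu2 nu1' nu2' [h1 h2] hI hO hN; split.
- apply: (trA _ _ _ _ h1) => v; move: (hI v) (hO v) (hN v) (inB _ _ h2 v);
    by_membership O2 v.
- apply: (trB _ _ _ _ h2) => v; move: (hI v) (hO v) (hN v) (inA _ _ h1 v);
    by_membership O1 v.
Qed.

Lemma transportable_setD :
  transportable (I1 `|` I2 `|` (O1 `+` O2)) O1 (A `\` B).
Proof.
move=> nu1 nu2 nu1' nu2' [h1 h2] hI hO hN; split.
- by apply: (trA _ _ _ _ h1) => // v I1v; apply: hI; left; left.
(* On [O1] minus [O2], inertia of the assumed primed pair in [B] gives [nu1 = nu1' = nu2' = nu2]; on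
   [O2] minus [O1], inertia of [A] gives [nu2 = nu1 = nu1' = nu2']. *)
- move=> h2'; apply: h2; apply: (trB _ _ _ _ h2') => v;
    move: (hI v) (hO v) (hN v) (inA _ _ h1 v) (inB _ _ h2' v);
    by_membership O1 v.
Qed.

Lemma inertial_comp : inertial (O1 `|` O2) (brv_comp A B).
Proof.
move=> nu1 nu2 [nu3 /= [h1 h2]] v; move: (inA _ _ h1 v) (inB _ _ h2 v).
by_membership O1 v.
Qed.

Lemma transportable_comp :
  transportable (I1 `|` (I2 `\` O1)) (O1 `|` O2) (brv_comp A B).
Proof.
move=> nu1 nu2 nu1' nu2' [nu3 /= [h1 h2]] hI hO hN.
(* Inertia of [A] forces this intermediate valuation. It matches [nu3] on [I2] because inputs of [B]
   outside [O1] are inputs of the composition. *)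
exists (merge O1 nu3 nu1'); split=> /=.
- apply: (trA _ _ _ _ h1); first by move=> v I1v; apply: hI; left.
  + exact: merge_in.
  + by move=> v nOv; rewrite merge_out.
- apply: (trB _ _ _ _ h2) => v; move: (hI v) (hO v) (hN v)
    (inA _ _ h1 v) (inB _ _ h2 v)
    (merge_in O1 nu3 nu1' v) (merge_out O1 nu3 nu1' v);
    by_membership O1 v.
Qed.

End Binary.

(** * Converse, cylindrifications and selections *)

Section Unary.
Context {I O : set V} {A : brv dom V}.
Hypotheses (inA : inertial O A) (trA : transportable I O A).

Lemma transportable_conv : transportable (O `|` I) O (brv_conv A).
Proof.
move=> nu1 nu2 nu1' nu2' /= h hI hO hN.
apply: (trA _ _ _ _ h) => v; move: (hI v) (hO v) (hN v) (inA _ _ h v);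
  by_membership O v.
Qed.

Variable Z : {fset V}.

Lemma inertial_cyl_l : inertial (O `|` [set` Z]) (brv_cyl_l Z A).
Proof.
move=> nu1 nu2 [nu3 /= [h hZ]] v; move: (inA _ _ h v) (hZ v).
by_membership O v.
Qed.

Lemma inertial_cyl_r : inertial (O `|` [set` Z]) (brv_cyl_r Z A).
Proof.
move=> nu1 nu2 [nu3 /= [h hZ]] v; move: (inA _ _ h v) (hZ v).
by_membership O v.
Qed.

Lemma transportable_cyl_l :
  transportable (I `\` [set` Z]) (O `|` [set` Z]) (brv_cyl_l Z A).
Proof.
move=> nu1 nu2 nu1' nu2' [nu3 /= [h hZ]] hI hO hN.
(* On [Z] outside [O], inertia gives [nu3 = nu2], which equals [nu2'] because [Z] belongs to the
   outputs. *)
exists (merge [set` Z] nu3 nu1'); split=> /=; last exact: merge_out.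
apply: (trA _ _ _ _ h) => v; move: (hI v) (hO v) (hN v) (hZ v) (inA _ _ h v)
  (merge_in [set` Z] nu3 nu1' v) (merge_out [set` Z] nu3 nu1' v);
  by_membership [set` Z] v.
Qed.

Lemma transportable_cyl_r :
  transportable I (O `|` [set` Z]) (brv_cyl_r Z A).
Proof.
move=> nu1 nu2 nu1' nu2' [nu3 /= [h hZ]] hI hO hN.
exists (merge O nu3 nu1'); split=> /=.
- apply: (trA _ _ _ _ h) => //; first exact: merge_in.
  by move=> v nOv; rewrite merge_out.
- move=> v; move: (hO v) (hN v) (hZ v)
    (merge_in O nu3 nu1' v) (merge_out O nu3 nu1' v);
    by_membership O v.
Qed.

Variables x y : V.

Lemma inertial_sel_lr :
  inertial (if x == y then O `\` [set x] else O) (brv_sel_lr x y A).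
Proof.
move=> nu1 nu2 [/= h e]; case: eqP => [exy|_]; last exact: inA.
move=> v nv; have [->|nvx] := EM (v = x); first by rewrite e exy.
by apply: (inA _ _ h) => Ov; apply: nv.
Qed.

Lemma transportable_sel_lr :
  transportable
    (if (x == y) && (y \notin O) then I
     else if (x != y) && (y \notin O) then I `|` [set x; y]
     else I `|` [set x])
    (if x == y then O `\` [set x] else O) (brv_sel_lr x y A).
Proof.
move=> nu1 nu2 nu1' nu2' [/= h e].
have [exy|nxy] := eqVneq x y; rewrite /= -?exy.
- rewrite -exy in e.
  have [Ox|nOx] := boolP (x \in O) => /= hI hO hN.
  (* The selection removes [x] from the outputs, so [nu2' x] copies [nu1' x]; making [x] an input
     recovers the value [nu2 x] that [A] still expects at its output [x]. *)
  + have ex : nu1' x = nu2' x by apply: hN => -[_ []].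
    have ex1 : nu1' x = nu1 x by apply: hI; right.
    split; last by rewrite /= ex.
    apply: (trA _ _ _ _ h) => v.
    * by move=> Iv; apply: hI; left.
    * move=> Ov; have [->|nvx] := EM (v = x); first by rewrite -ex ex1.
      by apply: hO.
    * by move=> nOv; apply: hN => -[].
  + move/negP: nOx; rewrite inE => nOx.
    split=> /=; last by apply: hN => -[].
    apply: (trA _ _ _ _ h) => // v.
    * by move=> Ov; apply: hO; split => // vx; apply: nOx; rewrite -vx.
    * by move=> nOv; apply: hN => -[].
- have [Oy|nOy] := boolP (y \in O) => /= hI hO hN.
  + move: Oy; rewrite inE => Oy.
    split; last by rewrite /= (hO y Oy) -e; apply: hI; right.
    by apply: (trA _ _ _ _ h) => // v Iv; apply: hI; left.
  + move/negP: nOy; rewrite inE => nOy.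
    split; first by apply: (trA _ _ _ _ h) => // v Iv; apply: hI; left.
    (* As [y] is not an output, its right value is its left value in both pairs, so the test only
       concerns inputs. *)
    rewrite /= -(hN y nOy) (hI x) ?(hI y) /=; [|by right; right|by right; left].
    by rewrite e (inA _ _ h).
Qed.

Lemma transportable_sel_l :
  transportable (if x == y then I else I `|` [set x; y]) O (brv_sel_l x y A).
Proof.
move=> nu1 nu2 nu1' nu2' [/= h e].
case: eqP => [<- hI hO hN|_ hI hO hN]; split=> //=; try exact: (trA _ _ _ _ h).
- by apply: (trA _ _ _ _ h) => // v Iv; apply: hI; left.
- by rewrite (hI x) ?(hI y) //; right; [right|left].
Qed.

Lemma transportable_sel_r :
  transportable (if x == y then I else I `|` ([set x; y] `\` O)) O
    (brv_sel_r x y A).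
Proof.
move=> nu1 nu2 nu1' nu2' [/= h e].
case: eqP => [<- hI hO hN|_ hI hO hN]; split=> //=; try exact: (trA _ _ _ _ h).
- by apply: (trA _ _ _ _ h) => // v Iv; apply: hI; left.
(* A tested variable is either an output, fixed by [hO], or an input whose value inertia carries to
   the right. *)
- have same v : [set x; y] v -> nu2' v = nu2 v.
    move=> xyv; have [Ov|nOv] := EM (O v); first exact: hO.
    by rewrite -(hN v nOv) (hI v) ?(inA _ _ h) //; right.
  by rewrite (same x) ?(same y) //; [right|left].
Qed.

End Unary.

Lemma transportable_atom (S : vocabulary) (D : interpretation S dom)
    (M : modname S) (xs : (iar M).-tuple V) (ys : (ar M - iar M).-tuple V) :
  transportable [set` xs] [set` ys] (brv_atom D xs ys).
Proof.
move=> nu1 nu2 nu1' nu2' [/= h _] hI hO hN; split=> //=.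
have -> : map_tuple nu1' xs = map_tuple nu1 xs.
  exact/val_inj/(agree_on_map _ _ _ hI).
have -> // : map_tuple nu2' ys = map_tuple nu2 ys.
exact/val_inj/(agree_on_map _ _ _ hO).
Qed.

Lemma sem_inertial_transportable (S : vocabulary) (D : interpretation S dom)
    (a : lif S V) :
  inertial (Osyn a) (sem a D) /\ transportable (Isyn a) (Osyn a) (sem a D).
Proof.
elim: a => [|M xs ys|a1 [i1 t1] a2 [i2 t2]|a1 [i1 t1] a2 [i2 t2]
  |a1 [i1 t1] a2 [i2 t2]|a1 [i1 t1] a2 [i2 t2]|a [i t]|Z a [i t]|Z a [i t]
  |x y a [i t]|x y a [i t]|x y a [i t]] /=; split.
- by move=> nu1 nu2 e v _; rewrite (e : nu1 = nu2).
- by move=> nu1 nu2 nu1' nu2' _ _ _ hN; apply/funext => v; apply: hN.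
- by move=> nu1 nu2 [].
- exact: transportable_atom.
- move=> nu1 nu2 [h|h]; [apply: inertial_sub i1 _ _ h|apply: inertial_sub i2 _ _ h].
  + exact: subsetUl.
  + exact: subsetUr.
- exact: transportable_setU.
- move=> nu1 nu2 [h1 h2] v; move: (i1 _ _ h1 v) (i2 _ _ h2 v).
  by_membership (Osyn a1) v.
- exact: transportable_setI.
- by move=> nu1 nu2 [h _]; apply: i1.
- exact: transportable_setD.
- exact: inertial_comp.
- exact: transportable_comp.
- by move=> nu1 nu2 /i h v nOv; apply: esym; apply: h.
- exact: transportable_conv.
- exact: inertial_cyl_l.
- exact: transportable_cyl_l.
- exact: inertial_cyl_r.
- exact: transportable_cyl_r.
- exact: inertial_sel_lr.
- exact: transportable_sel_lr.
- by move=> nu1 nu2 [h _]; apply: i.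
- exact: transportable_sel_l.
- by move=> nu1 nu2 [h _]; apply: i.
- exact: transportable_sel_r.
Qed.

End Soundness.

Theorem theorem3p24 (S : vocabulary) (dom : Type)
    (dom_countably_infinite : ([set: dom] #= [set: nat])%card)
    (V : choiceType) :
  sound_io_definition dom (@Isyn S V) (@Osyn S V).
Proof.
move=> a; split.
- by move=> M xs ys ->.
- move=> x [D [nu1 [nu2 [h neq]]]]; apply: contrapT => nOx; apply: neq.
  by have [+ _] := sem_inertial_transportable _ D a; apply.
- move=> D nu1 nu2 nu1' h hI.
  have [_ tr] := sem_inertial_transportable _ D a.
  exists (merge (Osyn a) nu2 nu1'); split; first exact: merge_in.
  apply: (tr _ _ _ _ h hI); first exact: merge_in.
  by move=> v nOv; rewrite merge_out.
Qed.
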